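(* Let $\lambda\in X^+$ be a $p$-core. Let $S_1$ be the set of pairs $(\alpha,l)$ with $\alpha=\varepsilon_i+\varepsilon_j$, $1\le i<j\le m$, $l\ge1$ an integer, $a:=\langle\lambda+\rho,\alpha^\vee\rangle-lp>0$, $(\lambda+\rho)_j-a<0$ and $\chi(s_{\alpha,l}\cdot\lambda)\ne0$. Let $S_2$ be the set of pairs $(2\varepsilon_i,l)$ with $1\le i\le m$, $l\ge1$ an integer, $\langle\lambda+\rho,(2\varepsilon_i)^\vee\rangle-lp>0$ and $\chi(s_{2\varepsilon_i,l}\cdot\lambda)\ne0$. Then there is a map $\varphi$ from $S_1$ to the set $\{2\varepsilon_1,\dots,2\varepsilon_m\}$ such that (i) $(\alpha,l)\mapsto(\varphi(\alpha,l),l)$ is a bijection from $S_1$ onto $S_2$, and (ii) $\chi(s_{\alpha,l}\cdot\lambda)=-\chi(s_{\varphi(\alpha,l),l}\cdot\lambda)$ for all $(\alpha,l)\in S_1$. Moreover, if $\alpha=\varepsilon_i+\varepsilon_j$ with $1\le i<j\le m$ and $l\ge1$ is an integer such that $j>l(\lambda)$, $\langle\lambda+\rho,\alpha^\vee\rangle-lp>0$ and $\chi(s_{\alpha,l}\cdot\lambda)\ne0$, then $(\alpha,l)\in S_1$.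
   Context: Setup: $p>2$ is a prime, $m\ge1$, weight lattice $X=\mathbb Z^m$ of $\mathrm{Sp}_{2m}$ with standard basis $\varepsilon_i$, standard inner product, $\alpha^\vee=2\alpha/\langle\alpha,\alpha\rangle$ (so $(\varepsilon_i+\varepsilon_j)^\vee=\varepsilon_i+\varepsilon_j$, $(2\varepsilon_i)^\vee=\varepsilon_i$). $X^+=\{\lambda\in\mathbb Z^m:\lambda_1\ge\dots\ge\lambda_m\ge0\}$; $l(\lambda)$ is the number of nonzero entries. $\rho=(m,m-1,\dots,1)$. $s_{\alpha,l}(x)=x-(\langle x,\alpha^\vee\rangle-lp)\alpha$, $w\cdot x=w(x+\rho)-\rho$. For $\mu\in X$, $\chi(\mu)$ is the Weyl character of type $C_m$; $\chi(\mu)=0$ iff some entry of $\mu+\rho$ is $0$ or two entries of $\mu+\rho$ are equal up to sign, and otherwise $\chi(\mu)=\det(w)\chi(w\cdot\mu)$ for the unique signed permutation $w$ with $w\cdot\mu$ dominant. A $p$-core is $\lambda\in X^+$ such that for all $i$ and all integers $l\ge1$ with $(\lambda+\rho)_i-lp>0$, the number $(\lambda+\rho)_i-lp$ occurs as an entry of $\lambda+\rho$. *)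

(* Defs.v *)
From mathcomp Require Import all_boot all_order all_algebra all_fingroup.
Set Implicit Arguments. Unset Strict Implicit. Unset Printing Implicit Defensive.
Import Order.TTheory GRing.Theory Num.Theory.
Local Open Scope ring_scope.

(* Weights of Sp_{2m}: X = Z^m, represented as functions 'I_m -> int.
   Index k : 'I_m (0-based) corresponds to epsilon_{k+1}. *)
Definition weight (m : nat) := {ffun 'I_m -> int}.

(* X^+ : lambda_1 >= ... >= lambda_m >= 0 *)
Definition dominant (m : nat) (lam : weight m) : bool :=
  [forall i : 'I_m, forall j : 'I_m, (i <= j)%N ==> (lam j <= lam i)]
  && [forall i : 'I_m, 0 <= lam i].

(* l(lambda): number of nonzero entries *)
Definition wlen (m : nat) (lam : weight m) : nat := #|[set i | lam i != 0]|.

(* rho = (m, m-1, ..., 1) *)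
Definition rho (m : nat) : weight m := [ffun i : 'I_m => ((m - i)%N)%:Z].

(* x + rho *)
Definition shift (m : nat) (x : weight m) : weight m := [ffun k => x k + rho m k].
(* x - rho *)
Definition unshift (m : nat) (x : weight m) : weight m := [ffun k => x k - rho m k].

(* Signed permutation w = (s, e) acting by (w x)_k = (-1)^(e k) x_(s k).
   These are exactly the elements of the Weyl group of type C_m. *)
Definition wact (m : nat) (s : 'S_m) (e : {ffun 'I_m -> bool}) (x : weight m)
  : weight m := [ffun k => (-1) ^+ (e k) * x (s k)].

(* det of the linear map wact s e *)
Definition wdet (m : nat) (s : 'S_m) (e : {ffun 'I_m -> bool}) : int :=
  (-1) ^+ (odd_perm s) * \prod_(k : 'I_m) (-1) ^+ (e k).

(* dot action w . x = w (x + rho) - rho *)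
Definition wdot (m : nat) (s : 'S_m) (e : {ffun 'I_m -> bool}) (x : weight m)
  : weight m := unshift (wact s e (shift x)).

(* Weyl character chi(mu) of type C_m, encoded by its coordinates in the
   Z-basis { chi(nu) : nu in X^+ } of Weyl characters of dominant weights:
   chi(mu) = sum_{w in W, w.mu dominant} det(w) chi(w.mu).
   (This gives chi(mu) = 0 iff mu+rho is singular, and otherwise
   chi(mu) = det(w) chi(w.mu) for the unique w with w.mu dominant.) *)
Definition chi (m : nat) (mu : weight m) : weight m -> int :=
  fun nu => if dominant nu then
      \sum_(s : 'S_m) \sum_(e : {ffun 'I_m -> bool})
         (if wdot s e mu == nu then wdet s e else 0)
    else 0.

(* p-core *)
Definition pcore (m p : nat) (lam : weight m) : Prop :=
  dominant lam /\
  forall (i : 'I_m) (l : nat), (0 < l)%N ->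
    0 < shift lam i - (l * p)%:Z ->
    exists k : 'I_m, shift lam k = shift lam i - (l * p)%:Z.

(* <x, alpha^vee> for alpha = eps_i + eps_j (i <> j): x_i + x_j *)
Definition pair_eps (m : nat) (x : weight m) (i j : 'I_m) : int := x i + x j.
(* <x, (2 eps_i)^vee> = x_i *)

(* s_{alpha,l}(x) = x - (<x,alpha^vee> - l p) alpha *)
Definition s_sum (m p : nat) (i j : 'I_m) (l : nat) (x : weight m) : weight m :=
  [ffun k => x k - (pair_eps x i j - (l * p)%:Z) * ((k == i)%:R + (k == j)%:R)].
Definition s_long (m p : nat) (i : 'I_m) (l : nat) (x : weight m) : weight m :=
  [ffun k => x k - (x i - (l * p)%:Z) * (2 * (k == i)%:R)].

(* dot actions s_{alpha,l} . lambda *)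
Definition sdot_sum (m p : nat) (i j : 'I_m) (l : nat) (lam : weight m) :=
  unshift (s_sum p i j l (shift lam)).
Definition sdot_long (m p : nat) (i : 'I_m) (l : nat) (lam : weight m) :=
  unshift (s_long p i l (shift lam)).

(* a := <lambda + rho, alpha^vee> - l p for alpha = eps_i + eps_j *)
Definition a_sum (m p : nat) (lam : weight m) (i j : 'I_m) (l : nat) : int :=
  pair_eps (shift lam) i j - (l * p)%:Z.

(* S_1: (eps_i + eps_j, l), i < j, l >= 1, a > 0, (lam+rho)_j - a < 0,
   chi(s_{alpha,l} . lam) <> 0 *)
Definition S1 (m p : nat) (lam : weight m) (i j : 'I_m) (l : nat) : Prop :=
  [/\ (i < j)%N, (0 < l)%N, 0 < a_sum p lam i j l,
      shift lam j - a_sum p lam i j l < 0 &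
      chi (sdot_sum p i j l lam) <> (fun _ => 0)].

(* S_2: (2 eps_i, l), l >= 1, <lam+rho,(2eps_i)^vee> - l p > 0,
   chi(s_{2eps_i,l} . lam) <> 0 *)
Definition S2 (m p : nat) (lam : weight m) (i : 'I_m) (l : nat) : Prop :=
  [/\ (0 < l)%N, 0 < shift lam i - (l * p)%:Z &
      chi (sdot_long p i l lam) <> (fun _ => 0)].

(* Main.v *)
Require Import Defs.
From mathcomp Require Import all_boot all_order all_algebra all_fingroup zify.
From Stdlib Require Import FunctionalExtensionality.
Set Implicit Arguments. Unset Strict Implicit.
Import Order.TTheory GRing.Theory Num.Theory.
Local Open Scope ring_scope.

(* Write x := lambda + rho; for dominant lambda, x is strictly decreasing and
   positive.  The proof rests on one property of Weyl characters: if
   mu' + rho = w (mu + rho) for a signed permutation w, then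
   chi(mu) = det(w) chi(mu').  Applied to the three reflections of
   determinant -1 (swap two entries, negate one entry, swap two entries and
   negate both) it shows that chi(mu) = 0 as soon as mu + rho has two equal
   entries, a zero entry, or two opposite entries.
   For (eps_i + eps_j, l) in S_1 the p-core property produces an index k
   with x_k = x_i - lp, and unless k = j the reflected weight has the
   opposite entries -x_k, x_k; hence x_j = x_i - lp.  Under this relation
   the two reflected weights s_{eps_i+eps_j,l}.lambda + rho and
   s_{2eps_i,l}.lambda + rho differ by negating coordinate j, so their
   characters are opposite, and (i,j,l) lies in S_1 iff (i,l) lies in S_2.
   The map phi(eps_i + eps_j, l) = 2 eps_i is therefore the required
   bijection, the inverse being supplied once more by the p-core property.
   The final assertion uses that the entries of x beyond l(lambda) are
   exactly m - j, ..., 1, so the reflected weight again has a zero entry or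
   a repeated entry unless x_i > lp. *)

(* Composition of signed permutations acting on weights. *)
Lemma wact_comp m (s t : 'S_m) (e f : {ffun 'I_m -> bool}) (y : weight m) :
  wact s e (wact t f y) = wact (s * t)%g [ffun k => e k (+) f (s k)] y.
Proof. by apply/ffunP => k; rewrite !ffunE permM signr_addb mulrA. Qed.

(* The determinant is multiplicative on signed permutations. *)
Lemma wdet_comp m (s t : 'S_m) (e f : {ffun 'I_m -> bool}) :
  wdet (s * t)%g [ffun k => e k (+) f (s k)] = wdet s e * wdet t f.
Proof.
rewrite /wdet odd_permM signr_addb.
under eq_bigr => k _ do rewrite ffunE signr_addb.
rewrite big_split /=.
have -> : \prod_(k < m) (-1) ^+ f (s k) = \prod_(k < m) (-1) ^+ f k :> int.
  by rewrite [RHS](reindex_perm s).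
rewrite !mulrA; congr (_ * _); rewrite -!mulrA; congr (_ * _); exact: mulrC.
Qed.

(* W-invariance of Weyl characters: chi(mu) = det(w) chi(mu') whenever
   mu' + rho = w (mu + rho); proved by reindexing the sum over W by w. *)
Lemma chi_reindex m (t : 'S_m) (f : {ffun 'I_m -> bool}) (mu mu' : weight m) :
  shift mu' = wact t f (shift mu) ->
  forall nu, chi mu nu = wdet t f * chi mu' nu.
Proof.
move=> Emu' nu; rewrite /chi; case: (dominant nu); last by rewrite mulr0.
rewrite !pair_big /=.
pose h (q : 'S_m * {ffun 'I_m -> bool}) :=
  ((q.1 * t)%g, [ffun k => q.2 k (+) f (q.1 k)]).
have h_inj : injective h.
  move=> [s e] [s' e'] [/mulIg Es /ffunP Ee]; subst s'; congr (_, _).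
  apply/ffunP => k; move: (Ee k); rewrite !ffunE.
  by case: (e k); case: (e' k); case: (f (s k)).
rewrite (reindex_inj h_inj) big_distrr /=; apply: eq_bigr => [[s e]] _ /=.
rewrite /wdot -wact_comp -Emu' wdet_comp.
by case: ifP; rewrite ?mulr0 // mulrC.
Qed.

(* The special case of an element of determinant -1. *)
Lemma chi_opp m (t : 'S_m) (f : {ffun 'I_m -> bool}) (mu mu' : weight m) :
  shift mu' = wact t f (shift mu) -> wdet t f = -1 ->
  chi mu = (fun nu => - chi mu' nu).
Proof.
move=> Emu' Hdet; apply: functional_extensionality => nu.
by rewrite (chi_reindex Emu') Hdet mulN1r.
Qed.

(* chi(mu) vanishes when mu + rho is fixed by an element of determinant -1. *)
Lemma chi_vanish m (t : 'S_m) (f : {ffun 'I_m -> bool}) (mu : weight m) :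
  wact t f (shift mu) = shift mu -> wdet t f = -1 -> chi mu = (fun _ => 0).
Proof.
move=> Hfix Hdet; apply: functional_extensionality => nu.
have := f_equal (fun g => g nu) (chi_opp (esym Hfix) Hdet) => /= E; lia.
Qed.

Section WeylChar.
Variable m : nat.
Implicit Types (lam mu y : weight m).

(* Coordinate formulas for the Weyl action and for x = lambda + rho. *)
Lemma wactE (s : 'S_m) (e : {ffun 'I_m -> bool}) y k :
  wact s e y k = (-1) ^+ (e k) * y (s k).
Proof. by rewrite ffunE. Qed.

Lemma shift_unshift y : shift (unshift y) = y.
Proof. by apply/ffunP => k; rewrite !ffunE subrK. Qed.

Lemma shiftE lam k : shift lam k = lam k + (m - k)%:Z.
Proof. by rewrite !ffunE. Qed.

(* Strict order on indices gives distinctness. *)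
Lemma lt_neq (i j : 'I_m) : (i < j)%N -> i != j.
Proof. by move=> h; rewrite -val_eqE /= neq_ltn h. Qed.

(* The sign change of the single coordinate a has determinant -1. *)
Lemma wdet_flip (a : 'I_m) : wdet 1%g [ffun k => k == a] = -1.
Proof.
rewrite /wdet odd_perm1 expr0 mul1r (bigD1 a) //= ffunE eqxx big1 ?mulr1 //.
by move=> k /negbTE ka; rewrite ffunE ka.
Qed.

(* Vanishing criterion: two equal entries of mu + rho. *)
Lemma chi_eq_entries mu (a b : 'I_m) : a != b -> shift mu a = shift mu b ->
  chi mu = (fun _ => 0).
Proof.
move=> ab E; apply: (@chi_vanish _ (tperm a b) [ffun => false]).
  apply/ffunP => k; rewrite wactE ffunE expr0 mul1r.
  by case: tpermP => [->|->|].
by rewrite /wdet odd_tperm ab big1 // => k _; rewrite ffunE.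
Qed.

(* Vanishing criterion: a zero entry of mu + rho. *)
Lemma chi_zero_entry mu (a : 'I_m) : shift mu a = 0 -> chi mu = (fun _ => 0).
Proof.
move=> E; apply: (@chi_vanish _ 1%g [ffun k => k == a]); last exact: wdet_flip.
apply/ffunP => k; rewrite wactE perm1 ffunE.
by case: eqP => [->|]; rewrite ?E ?mulr0 ?expr0 ?mul1r.
Qed.

(* Vanishing criterion: two opposite entries of mu + rho. *)
Lemma chi_opp_entries mu (a b : 'I_m) : a != b -> shift mu a = - shift mu b ->
  chi mu = (fun _ => 0).
Proof.
move=> ab E; pose f := [ffun k => (k == a) || (k == b)].
have fE k : f k = (k == a) || (k == b) by rewrite ffunE.
apply: (@chi_vanish _ (tperm a b) f).
  apply/ffunP => k; rewrite wactE fE.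
  case: tpermP => [->|->|/eqP/negbTE -> /eqP/negbTE ->]; rewrite ?eqxx ?orbT.
  - by rewrite E expr1 mulN1r.
  - by rewrite E expr1 mulN1r opprK.
  - by rewrite expr0 mul1r.
rewrite /wdet odd_tperm ab (bigD1 a) //= (bigD1 b) /=; last by rewrite eq_sym.
rewrite !fE !eqxx orbT big1 ?mulr1 //.
by move=> k /andP [/negbTE ka /negbTE kb]; rewrite fE ka kb.
Qed.

(* For dominant lambda, the entries of lambda + rho are strictly decreasing
   and positive, and lambda vanishes beyond its length l(lambda). *)
Lemma dominant_le lam (i j : 'I_m) : dominant lam -> (i <= j)%N -> lam j <= lam i.
Proof. by case/andP => /forallP /(_ i) /forallP /(_ j) /implyP H _ /H. Qed.

Lemma dominant_ge0 lam k : dominant lam -> 0 <= lam k.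
Proof. by case/andP => _ /forallP. Qed.

Lemma shift_decr lam (i j : 'I_m) : dominant lam -> (i < j)%N ->
  shift lam j < shift lam i.
Proof.
move=> D ij; have := dominant_le D (ltnW ij); rewrite !shiftE.
have := ltn_ord j; lia.
Qed.

Lemma shift_gt0 lam k : dominant lam -> 0 < shift lam k.
Proof.
by move=> D; have := dominant_ge0 k D; have := ltn_ord k; rewrite shiftE; lia.
Qed.

Lemma shift_inj lam (i j : 'I_m) : dominant lam ->
  shift lam i = shift lam j -> i = j.
Proof.
move=> D E; case: (ltngtP i j) => [h|h|/val_inj //].
- by have := shift_decr D h; rewrite E ltxx.
- by have := shift_decr D h; rewrite E ltxx.
Qed.

Lemma dominant_tail lam (k : 'I_m) : dominant lam -> (wlen lam <= k)%N ->
  lam k = 0.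
Proof.
move=> D hk; apply/eqP; apply: contraT => nz.
have km : (k.+1 <= m)%N := ltn_ord k.
pose f (s : 'I_k.+1) : 'I_m := widen_ord km s.
have f_inj : injective f by move=> a b E; apply: val_inj; exact: (congr1 val E).
have pos : 0 < lam k by rewrite lt_def nz (dominant_ge0 k D).
have : (#|[set f s | s in 'I_k.+1]| <= wlen lam)%N.
  apply: subset_leq_card; apply/subsetP => _ /imsetP [s _ ->].
  have sk : (f s <= k)%N by rewrite /= -ltnS.
  by rewrite inE gt_eqF // (lt_le_trans pos (dominant_le D sk)).
rewrite card_imset // card_ord; lia.
Qed.

(* Coordinates of the affine reflections s_{eps_i + eps_j, l} and
   s_{2 eps_i, l} applied to a weight y. *)
Section Reflections.
Variables (p l : nat) (i j : 'I_m) (y : weight m).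
Hypothesis ij : i != j.

Lemma s_sum_i : s_sum p i j l y i = (l * p)%:Z - y j.
Proof. rewrite ffunE eqxx (negbTE ij) /pair_eps /=; lia. Qed.

Lemma s_sum_j : s_sum p i j l y j = (l * p)%:Z - y i.
Proof. rewrite ffunE eqxx eq_sym (negbTE ij) /pair_eps /=; lia. Qed.

Lemma s_sum_other k : k != i -> k != j -> s_sum p i j l y k = y k.
Proof. move=> /negbTE ki /negbTE kj; rewrite ffunE ki kj /=; lia. Qed.

End Reflections.

Lemma s_long_i p l (i : 'I_m) y : s_long p i l y i = 2 * (l * p)%:Z - y i.
Proof. rewrite ffunE eqxx /=; lia. Qed.

Lemma s_long_other p l (i : 'I_m) y k : k != i -> s_long p i l y k = y k.
Proof. move=> /negbTE ki; rewrite ffunE ki /=; lia. Qed.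

(* If x_j = x_i - lp, then s_{2eps_i,l}.lambda + rho is obtained from
   s_{eps_i+eps_j,l}.lambda + rho by negating coordinate j, so the two
   characters are opposite. *)
Lemma chi_sum_long_opp p l lam (i j : 'I_m) : i != j ->
  shift lam j = shift lam i - (l * p)%:Z ->
  chi (sdot_sum p i j l lam) = (fun nu => - chi (sdot_long p i l lam) nu).
Proof.
move=> ij E.
have Hflip : shift (sdot_long p i l lam) =
             wact 1%g [ffun k => k == j] (shift (sdot_sum p i j l lam)).
  rewrite !shift_unshift; apply/ffunP => k; rewrite wactE perm1.
  have -> : [ffun k => k == j] k = (k == j) by rewrite ffunE.
  have [->|ki] := eqVneq k i.
    by rewrite (negbTE ij) expr0 mul1r s_long_i s_sum_i // E; lia.
  have [->|kj] := eqVneq k j.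
    rewrite expr1 mulN1r s_long_other; last by rewrite eq_sym.
    by rewrite s_sum_j // E; lia.
  by rewrite expr0 mul1r s_long_other // s_sum_other.
exact: chi_opp Hflip (wdet_flip j).
Qed.

(* Membership in S_1 forces x_j = x_i - lp: the p-core property gives an
   entry x_k = x_i - lp, and for k <> j the reflected weight has the
   opposite entries -x_k (at j) and x_k (at k). *)
Lemma S1_shift p lam (i j : 'I_m) l : (0 < p)%N -> pcore p lam ->
  S1 p lam i j l -> shift lam j = shift lam i - (l * p)%:Z.
Proof.
move=> p0 [_ Hcore] [ij l0 ha hj hchi].
move: ha hj; rewrite /a_sum /pair_eps => ha hj.
have xi : 0 < shift lam i - (l * p)%:Z by lia.
have [k Ek] := Hcore i l l0 xi.
have [<- //|kj] := eqVneq k j.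
have lp0 : (0 < l * p)%N by rewrite muln_gt0 l0 p0.
have ki : k != i by apply/eqP => Eki; move: Ek; rewrite Eki; lia.
case: hchi; apply: (@chi_opp_entries _ k j kj).
have ij' := lt_neq ij.
by rewrite shift_unshift s_sum_other // s_sum_j //; lia.
Qed.

(* Under x_j = x_i - lp with i < j, membership of (eps_i + eps_j, l) in S_1
   is equivalent to membership of (2 eps_i, l) in S_2. *)
Lemma S1_S2 p lam (i j : 'I_m) l : dominant lam -> (i < j)%N -> (0 < l)%N ->
  shift lam j = shift lam i - (l * p)%:Z ->
  S1 p lam i j l <-> S2 p lam i l.
Proof.
move=> D ij l0 E; have xj := shift_gt0 j D.
have chiE := chi_sum_long_opp (lt_neq ij) E.
rewrite /S1 /S2 /a_sum /pair_eps chiE; split.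
- case=> _ _ _ _ nz; split => //; first lia.
  by move=> Z; apply: nz; rewrite Z; apply: functional_extensionality => nu; lia.
- case=> _ _ nz; split => //; try lia.
  move=> Z; apply: nz; apply: functional_extensionality => nu.
  by have := f_equal (fun g => g nu) Z => /=; lia.
Qed.

(* The final assertion: for j beyond l(lambda), a non-vanishing reflected
   character forces x_i > lp, i.e. x_j - a < 0.  Otherwise the j-th entry
   lp - x_i of the reflected weight is 0 or one of the values 1..m-j-1,
   which are the entries x_t = m - t of lambda + rho for t > j. *)
Lemma S1_of_tail p lam (i j : 'I_m) l : dominant lam -> (i < j)%N ->
  (0 < l)%N -> (wlen lam <= j)%N -> 0 < a_sum p lam i j l ->
  chi (sdot_sum p i j l lam) <> (fun _ => 0) -> S1 p lam i j l.
Proof.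
move=> D ij l0 hw ha hchi; split => //; rewrite /a_sum /pair_eps in ha *.
suff : ~ (shift lam i <= (l * p)%:Z) by lia.
move=> Hle; apply: hchi.
have [Heq|Hne] := eqVneq (shift lam i) (l * p)%:Z.
  by apply: (@chi_zero_entry _ j); rewrite shift_unshift s_sum_j ?lt_neq // Heq subrr.
have [n En] : exists n : nat, (l * p)%:Z - shift lam i = n%:Z.
  by exists `|(l * p)%:Z - shift lam i|%N; lia.
have xj := shiftE lam j; rewrite (dominant_tail D hw) add0r in xj.
have hn : (0 < n < m - j)%N.
  have : (l * p)%:Z - shift lam i != 0 by rewrite subr_eq0 eq_sym.
  by rewrite En; lia.
have tm : (m - n < m)%N by lia.
pose t : 'I_m := Ordinal tm.
have jt : (j < t)%N by rewrite /=; lia.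
have xt := shiftE lam t.
rewrite (dominant_tail D (leq_trans hw (ltnW jt))) add0r /= in xt.
have ij' := lt_neq ij.
have tj : t != j by rewrite eq_sym lt_neq.
have ti : t != i by rewrite eq_sym lt_neq // (ltn_trans ij jt).
apply: (@chi_eq_entries _ t j tj).
by rewrite shift_unshift s_sum_other // s_sum_j // xt En; lia.
Qed.

End WeylChar.

Unset Implicit Arguments. Set Strict Implicit.
Theorem lemma2p2 (p m : nat) (lam : weight m) :
  prime p -> (2 < p)%N -> (0 < m)%N -> pcore p lam ->
  (exists phi : 'I_m -> 'I_m -> nat -> 'I_m,
     (* (i) (alpha,l) |-> (phi(alpha,l), l) is a bijection S1 -> S2 *)
     (forall i j l, S1 p lam i j l -> S2 p lam (phi i j l) l) /\
     (forall i j l i' j' l', S1 p lam i j l -> S1 p lam i' j' l' ->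
        phi i j l = phi i' j' l' -> l = l' -> i = i' /\ j = j') /\
     (forall k l, S2 p lam k l -> exists i j, S1 p lam i j l /\ phi i j l = k) /\
     (* (ii) *)
     (forall i j l, S1 p lam i j l ->
        chi (sdot_sum p i j l lam)
        = (fun nu => - chi (sdot_long p (phi i j l) l lam) nu))) /\
  (forall (i j : 'I_m) (l : nat), (i < j)%N -> (0 < l)%N ->
     (wlen lam <= j)%N -> 0 < a_sum p lam i j l ->
     chi (sdot_sum p i j l lam) <> (fun _ => 0) ->
     S1 p lam i j l).
Proof.
move=> _ p2 _ core; have p0 : (0 < p)%N by lia.
have D : dominant lam by case: core.
split; last by move=> i j l; exact: S1_of_tail.
exists (fun i _ _ => i); split; [|split; [|split]].
- move=> i j l H1; have [ij l0 _ _ _] := H1.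
  by apply/(S1_S2 D ij l0 (S1_shift p0 core H1)).
- move=> i j l i' j' l' H1 H2 /= Ei El; subst i' l'; split => //.
  by apply: (shift_inj D); rewrite (S1_shift p0 core H1) (S1_shift p0 core H2).
- move=> k l H2; have [l0 hk _] := H2.
  have [t Et] := core.2 k l l0 hk.
  have kt : (k < t)%N.
    case: (ltngtP k t) => [//|tk|/val_inj kt]; first by have := shift_decr D tk; lia.
    have lp0 : (0 < l * p)%N by rewrite muln_gt0 l0 p0.
    by move: Et; rewrite kt; lia.
  by exists k, t; split => //; apply/(S1_S2 D kt l0 Et).
- move=> i j l H1; have [ij _ _ _ _] := H1.
  exact: chi_sum_long_opp (lt_neq ij) (S1_shift p0 core H1).
Qed.
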